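(* Let $p$ be an odd prime, let $q\in\mathbb{C}_p$ with $|1-q|_p<p^{-\frac{1}{p-1}}$, let $x\in\mathbb{Z}_p$, and let $d$ be a positive odd integer. For every integer $n\ge0$, \[ Ch_{n,q}(x)=\frac{[2]_q}{[2]_{q^d}}\sum_{k=0}^n[d]_q^k\left(\sum_{a=0}^{d-1}(-q)^a\,\mathcal{E}_{k,q^d}\!\left(\tfrac{a+x}{d}\right)S_1(n,k)\right). \]
   Context: For $x\in\mathbb{Z}_p$, $[x]_q=\frac{q^x-1}{q-1}$; $[2]_q=1+q$, $[2]_{q^d}=1+q^d$, $[d]_q=\frac{q^d-1}{q-1}$. For $Q\in\{q,q^d\}$, the fermionic $p$-adic $Q$-integral of a continuous $f:\mathbb{Z}_p\to\mathbb{C}_p$ is $\int_{\mathbb{Z}_p}f(y)\,d\mu_{-Q}(y)=\lim_{N\to\infty}\frac{1}{[p^N]_{-Q}}\sum_{y=0}^{p^N-1}f(y)(-Q)^y$, where $[m]_{-Q}=\frac{1-(-Q)^m}{1+Q}$. The Carlitz $q$-Euler polynomials with base $q^d$ are $\mathcal{E}_{k,q^d}(z)=\int_{\mathbb{Z}_p}[z+y]_{q^d}^k\,d\mu_{-q^d}(y)$, where for $z=\frac{a+x}{d}$ one interprets $[z+y]_{q^d}=\frac{q^{a+x+dy}-1}{q^d-1}$. The Carlitz-type $q$-Changhee polynomials $Ch_{n,q}(x)$ are defined by $\int_{\mathbb{Z}_p}(1+t)^{[x+y]_q}\,d\mu_{-q}(y)=\sum_{n\ge0}Ch_{n,q}(x)\frac{t^n}{n!}$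 for $t\in\mathbb{C}_p$ with $|t|_p<p^{-\frac{1}{p-1}}$. $S_1(n,k)$ are the (signed) Stirling numbers of the first kind, $x(x-1)\cdots(x-n+1)=\sum_{k=0}^nS_1(n,k)x^k$. *)

(* Defs.v *)
From HB Require Import structures.
From mathcomp Require Import all_boot all_order all_algebra.
From mathcomp Require Import all_classical all_reals all_analysis.

Set Implicit Arguments.
Unset Strict Implicit.
Unset Printing Implicit Defensive.

Import Order.TTheory GRing.Theory Num.Theory.

Local Open Scope classical_set_scope.
Local Open Scope ring_scope.

Record valuedClosedField (R : realType) := ValuedClosedField {
  vcf_field : closedFieldType ;
  vcf_abs : vcf_field -> R ;
  vcf_abs_ge0 : forall x, 0 <= vcf_abs x ;
  vcf_abs_eq0 : forall x, (vcf_abs x == 0) = (x == 0) ;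
  vcf_absM : {morph vcf_abs : x y / x * y} ;
  vcf_absD : forall x y,
    vcf_abs (x + y) <= Num.max (vcf_abs x) (vcf_abs y) }.

Definition vcf_sort (R : realType) (K : valuedClosedField R) : Type :=
  vcf_field K.
Coercion vcf_sort : valuedClosedField >-> Sortclass.

HB.instance Definition _ (R : realType) (K : valuedClosedField R) :=
  GRing.ClosedField.copy (vcf_sort K) (vcf_field K).
HB.instance Definition _ (R : realType) (K : valuedClosedField R) :=
  isPointed.Build (vcf_sort K) 0.

Definition vabs (R : realType) (K : valuedClosedField R) (x : K) : R :=
  vcf_abs (x : vcf_field K).

Section Distance.
Context {R : realType} {K : valuedClosedField R}.
Implicit Types x y z : K.

Lemma vabsM x y : vabs (x * y) = vabs x * vabs y.
Proof. exact: vcf_absM. Qed.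

Lemma vabsD x y : vabs (x + y) <= Num.max (vabs x) (vabs y).
Proof. exact: vcf_absD. Qed.

Lemma vabs_eq0 x : (vabs x == 0) = (x == 0).
Proof. exact: vcf_abs_eq0. Qed.

Lemma vabs_ge0 x : 0 <= vabs x.
Proof. exact: vcf_abs_ge0. Qed.

Lemma vabs1 : vabs (1 : K) = 1.
Proof.
have n0 : vabs (1 : K) != 0 by rewrite vabs_eq0 oner_eq0.
by apply: (mulfI n0); rewrite -vabsM !mulr1.
Qed.

Lemma vabs0 : vabs (0 : K) = 0.
Proof. by apply/eqP; rewrite vabs_eq0. Qed.

Lemma vabsN x : vabs (- x) = vabs x.
Proof.
have N1 : vabs (- 1 : K) = 1.
  apply/eqP; rewrite -(@pexpr_eq1 _ _ 2) ?vabs_ge0 //.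
  by rewrite expr2 -vabsM mulrNN mulr1 vabs1.
by rewrite -mulN1r vabsM N1 mul1r.
Qed.

Let dist x y := vabs (x - y).

Let distxx x : dist x x = 0.
Proof. by rewrite /dist subrr vabs0. Qed.

Let dist_positivity x y : dist x y = 0 -> x = y.
Proof. by move=> /eqP; rewrite vabs_eq0 subr_eq0 => /eqP. Qed.

Let dist_sym x y : dist x y = dist y x.
Proof. by rewrite /dist -vabsN opprB. Qed.

Let dist_triangle y x z : dist x z <= dist x y + dist y z.
Proof.
rewrite /dist -(subrKA y); apply: le_trans (vabsD _ _) _.
by rewrite ge_max lerDl lerDr !vabs_ge0.
Qed.

HB.instance Definition _ := isMetric.Build R (vcf_sort K)
  distxx dist_positivity dist_sym dist_triangle.

End Distance.

Definition padic_num {R : realType} {K : valuedClosedField R} : set K :=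
  closure (range (@ratr K)).

Definition padic_int {R : realType} {K : valuedClosedField R} : set K :=
  [set x | padic_num x /\ vabs x <= 1].

(* K is the completion of an algebraic closure of Q_p, with |p| = 1/p. This
   determines K up to isometric isomorphism: K being algebraically closed, its
   elements algebraic over Q_p form an algebraic closure of Q_p. *)
Definition is_padic_complex (R : realType) (p : nat)
    (K : valuedClosedField R) : Prop :=
  [/\ vabs (p%:R : K) = (p%:R)^-1,
      (forall F : set_system K, ProperFilter F -> cauchy F -> cvg F) &
      dense [set z : K | exists P : {poly K},
        [/\ P != 0, (forall i, padic_num P`_i) & root P z]]].

Definition exp_radius (R : realType) (p : nat) : R :=
  p%:R `^ (- (p.-1%:R)^-1).

Section CarlitzChanghee.
Context {R : realType} (p : nat) {Cp : valuedClosedField R}.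
Implicit Types (q Q t u x w z : Cp) (f : Cp -> Cp) (d k n N : nat).

Definition pbinom z n : Cp := (\prod_(i < n) (z - i%:R)) / (n`!)%:R.

(* The power u ^ z, for |u - 1| < exp_radius and |z| <= 1, as the sum of the
   binomial series. *)
Definition ppow u z : Cp :=
  lim (series (fun n => pbinom z n * (u - 1) ^+ n) @ \oo).

(* The q ^ d-analogue of w / d, that is (q ^ w - 1) / (q ^ d - 1), the
   numerator being (q ^ d) ^ (w / d). It makes sense for every w in Z_p, even
   when w / d is not in Z_p; at q = 1 it is the limit value w / d. *)
Definition qnum_frac q d w : Cp :=
  if q == 1 then w / d%:R else (ppow q w - 1) / (q ^+ d - 1).

Definition qnum q x : Cp := qnum_frac q 1 x.

(* (1 / [p ^ N]_(-Q)) * \sum_(y < p ^ N) f(y) (-Q) ^ y *)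
Definition fermionic_sum Q f N : Cp :=
  ((1 - (- Q) ^+ (p ^ N)) / (1 + Q))^-1 *
  \sum_(0 <= y < p ^ N) f y%:R * (- Q) ^+ y.

Definition fermionic_int Q f : Cp := lim (fermionic_sum Q f @ \oo).

(* The Carlitz polynomial E_(k, q ^ d) at z = w / d, where
   [z + y]_(q ^ d) = (q ^ (w + d y) - 1) / (q ^ d - 1). *)
Definition qEuler q d k w : Cp :=
  fermionic_int (q ^+ d) (fun y => qnum_frac q d (w + d%:R * y) ^+ k).

Definition Changhee_gf q x t y : Cp := ppow (1 + t) (qnum q (x + y)).

Definition is_qChanghee q x (c : nat -> Cp) : Prop :=
  forall t, vabs t < exp_radius R p ->
    cvg (fermionic_sum q (Changhee_gf q x t) @ \oo) /\
    series (fun n => c n * (t ^+ n / (n`!)%:R)) @ \oo -->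
      fermionic_int q (Changhee_gf q x t).

(* The sequence n |-> Ch_(n, q)(x) determined by its generating function; the
   default value is used only if there is no such sequence. *)
Definition qChanghee q x : nat -> Cp := xget (fun=> 0) (is_qChanghee q x).

End CarlitzChanghee.

Section PowerNat.
Context {R : realType} (p : nat) {Cp : valuedClosedField R}.

Lemma padic_complex_char0 : prime p -> is_padic_complex p Cp ->
  [pchar Cp] =i pred0.
Proof.
move=> p_prime [absp _ _] l; apply/negP => lchar.
have l_prime : prime l by case/andP: lchar.
have p1 : 1 < (p%:R : R) by rewrite ltr1n prime_gt1.
have : vabs (p%:R ^+ l : Cp) = vabs (p%:R : Cp).
  by rewrite -(pFrobenius_autE lchar) pFrobenius_aut_nat.
have vX (x : Cp) m : vabs (x ^+ m) = vabs x ^+ m.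
  by elim: m => [|m IH]; rewrite ?expr0 ?vabs1 // !exprS vabsM IH.
rewrite vX absp exprVn => /invr_inj/eqP; rewrite -[X in _ == X]expr1.
have p0 : 0 < (p%:R : R) := lt_trans ltr01 p1.
by move=> /eqP/(ieexprIn p0 (negbT (gt_eqF p1))) lE; rewrite lE in l_prime.
Qed.

Lemma pbinom_nat (m n : nat) : [pchar Cp] =i pred0 ->
  pbinom (m%:R : Cp) n = 'C(m, n)%:R.
Proof.
move=> char0; have fn0 : (n`!%:R : Cp) != 0.
  by rewrite ((GRing.pcharf0P _).1 char0) -lt0n fact_gt0.
apply: (mulIf fn0); rewrite /pbinom divfK // -natrM bin_ffact ffact_prod natr_prod.
case: (leqP n m) => [nm|mn].
  by apply: eq_bigr => i _; rewrite natrB // ltnW // (leq_trans (ltn_ord i)).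
rewrite (bigD1 (Ordinal mn)) //= subrr mul0r.
by rewrite (bigD1 (Ordinal mn)) //= subnn mul0r.
Qed.

(* At natural exponents, [ppow] is the ring power. *)
Lemma ppow_nat (u : Cp) (m : nat) : prime p -> is_padic_complex p Cp ->
  ppow u m%:R = u ^+ m.
Proof.
move=> pp hC; apply: cvg_lim; first exact: metric_hausdorff.
apply: cvg_near_cst; exists m.+1 => // n /= mn.
rewrite /series /= -[in RHS](subrK 1 u) [in RHS]addrC exprDn.
rewrite (big_cat_nat (leq0n _) mn) /= [X in _ + X]big_nat_cond.
rewrite [X in _ + X]big1 ?addr0 => [|k /andP[/andP[mk _] _]].
  rewrite big_mkord; apply: eq_bigr => i _.
  rewrite pbinom_nat; last exact: padic_complex_char0.
  by rewrite expr1n mul1r mulr_natl.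
by rewrite pbinom_nat ?bin_small ?mul0r //; exact: padic_complex_char0.
Qed.
End PowerNat.

(* Signed Stirling numbers of the first kind. *)
Definition stirling1 (n k : nat) : int :=
  (\prod_(i < n) ('X - (i%:R)%:P) : {poly int})`_k.

(* Main.v *)
(* Everything is integrated against (-Q)^y, so a fermionic sum is, up to the
   factor (1 + Q) / (1 + Q^(p^N)), an alternating sum of g(y) = f(y) Q^y over
   y < p^N. When g is uniformly continuous for the p-adic topology, the
   alternating sum over m p^N terms, m odd, splits into m blocks that cancel in
   pairs up to a small error, leaving one block. With m = p this makes the sums
   Cauchy; with m = d, after sorting by residues mod d, it gives the relation
   between the integrals for q and q^d.
   Expanding (1 + t)^[x+y]_q by the binomial series and integrating term by term
   (the tails are uniformly small since |n!| >= exp_radius^(n-1), by Legendre's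
   formula) shows that Ch_n is the sum over k of S_1(n,k) times the integral of
   [x+y]_q^k, and [x+a+dy]_q = [d]_q [(a+x)/d + y]_(q^d). *)
Require Import Defs.
From mathcomp Require Import all_boot all_order all_algebra.
From mathcomp Require Import all_classical all_reals all_analysis.
From mathcomp Require Import ring.

Import Order.TTheory GRing.Theory Num.Theory.
Local Open Scope classical_set_scope.
Local Open Scope ring_scope.

Set Implicit Arguments.
Unset Strict Implicit.

(** * Limits and series in an ultrametric valued field *)

Section Ultrametric.
Import numFieldNormedType.Exports.
Context {R : realType} {K : valuedClosedField R}.
Implicit Types (x y l : K) (u v : nat -> K) (e B : R).

Lemma vabs_subC x y : vabs (x - y) = vabs (y - x).
Proof. by rewrite -vabsN opprB. Qed.

Lemma vabsX x n : vabs (x ^+ n) = vabs x ^+ n.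
Proof. by elim: n => [|n IH]; rewrite ?expr0 ?vabs1 // !exprS vabsM IH. Qed.

Lemma vabs_gt0 x : (0 < vabs x) = (x != 0).
Proof. by rewrite lt_def vabs_ge0 andbT vabs_eq0. Qed.

Lemma vabsV x : vabs x^-1 = (vabs x)^-1.
Proof.
have [->|x0] := eqVneq x 0; first by rewrite invr0 vabs0 invr0.
have vx0 : vabs x != 0 by rewrite vabs_eq0.
by apply: (mulfI vx0); rewrite -vabsM !mulfV // vabs1.
Qed.

Lemma vabs_prod I (r : seq I) (P : pred I) (F : I -> K) :
  vabs (\prod_(i <- r | P i) F i) = \prod_(i <- r | P i) vabs (F i).
Proof. exact: (big_morph _ vabsM vabs1). Qed.

Lemma vabsD_le x y B : vabs x <= B -> vabs y <= B -> vabs (x + y) <= B.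
Proof. by move=> xB yB; apply: le_trans (vabsD _ _) _; rewrite ge_max xB yB. Qed.

Lemma vabsB_le x y B : vabs x <= B -> vabs y <= B -> vabs (x - y) <= B.
Proof. by move=> xB yB; apply: vabsD_le; rewrite ?vabsN. Qed.

Lemma vabsD_lt x y B : vabs x < B -> vabs y < B -> vabs (x + y) < B.
Proof. by move=> xB yB; apply: le_lt_trans (vabsD _ _) _; rewrite gt_max xB yB. Qed.

Lemma vabsB_lt x y B : vabs x < B -> vabs y < B -> vabs (x - y) < B.
Proof. by move=> xB yB; apply: vabsD_lt; rewrite ?vabsN. Qed.

Lemma vabsM_le x y e B : vabs x <= e -> vabs y <= B -> vabs (x * y) <= e * B.
Proof. by move=> xe yB; rewrite vabsM ler_pM ?vabs_ge0. Qed.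

Lemma vabsX_le1 x n : vabs x <= 1 -> vabs (x ^+ n) <= 1.
Proof. by move=> x1; rewrite vabsX exprn_ile1 // vabs_ge0. Qed.

Lemma vabs_sum_le (I : eqType) (r : seq I) (P : pred I) (F : I -> K) B :
  0 <= B -> (forall i, i \in r -> P i -> vabs (F i) <= B) ->
  vabs (\sum_(i <- r | P i) F i) <= B.
Proof.
move=> B0 FB; rewrite big_seq_cond.
elim/big_ind: _ => [|x y|i /andP[ir Pi]]; rewrite ?vabs0 //.
- exact: vabsD_le.
- exact: FB.
Qed.

Lemma vabs_sum_lt (I : eqType) (r : seq I) (P : pred I) (F : I -> K) B :
  0 < B -> (forall i, i \in r -> P i -> vabs (F i) < B) ->
  vabs (\sum_(i <- r | P i) F i) < B.
Proof.
move=> B0 FB; rewrite big_seq_cond.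
elim/big_ind: _ => [|x y|i /andP[ir Pi]]; rewrite ?vabs0 //.
- exact: vabsD_lt.
- exact: FB.
Qed.

Lemma vabs_natr_le1 n : vabs (n%:R : K) <= 1.
Proof.
by elim: n => [|n IH]; rewrite ?vabs0 ?ler01 // -natr1 vabsD_le ?vabs1.
Qed.

(** If the sum were smaller than [x], then [x], being the sum minus [y], would be smaller than
    itself. *)
Lemma vabs_dominant x y : vabs y < vabs x -> vabs (x + y) = vabs x.
Proof.
move=> yx; apply/eqP; rewrite eq_le vabsD_le ?(ltW yx) //=.
rewrite leNgt; apply/negP => xyx.
by have := vabsB_lt xyx yx; rewrite addrK ltxx.
Qed.

Lemma vabs_near1 x : vabs (x - 1) < 1 -> vabs x = 1.
Proof. by move=> x1; rewrite -(subrK 1 x) addrC vabs_dominant ?vabs1. Qed.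

Lemma cvg_vabsP u l : u @ \oo --> l <->
  forall e, 0 < e -> \forall n \near \oo, vabs (u n - l) < e.
Proof.
rewrite cvg_ballP; split => H e e0; move: (H e e0); apply: filterS => n;
  by rewrite ballEmdist /= vabs_subC.
Qed.

Lemma cvg_vabs_unique u l l' : u @ \oo --> l -> u @ \oo --> l' -> l = l'.
Proof. exact: (cvg_unique (@metric_hausdorff R K)). Qed.

Lemma cvg_vabs_lim u l : u @ \oo --> l -> lim (u @ \oo) = l.
Proof. exact: (cvg_lim (@metric_hausdorff R K)). Qed.

(** Otherwise some term is within [B] of [x] and also closer to [l] than [x] is, which violates the
    ultrametric inequality. Every limit estimate below is transferred from partial sums in this
    way. *)
Lemma cvg_vabs_le u l x B : u @ \oo --> l ->
  (\forall n \near \oo, vabs (u n - x) <= B) -> vabs (l - x) <= B.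
Proof.
move=> /cvg_vabsP ul uB; rewrite leNgt; apply/negP => Bl.
have [m /(le_trans (vabs_ge0 _)) B0] := filter_ex uB.
have [n [n1 n2]] := filter_ex (filterI uB (ul _ (le_lt_trans B0 Bl))).
have := vabsB_lt (le_lt_trans n1 Bl) n2.
by rewrite opprB addrC subrKA ltxx.
Qed.

Lemma cvg_vabs_cst x : (fun _ : nat => x) @ \oo --> x.
Proof. exact: cvg_cst. Qed.

Lemma cvg_vabsD u v l l' : u @ \oo --> l -> v @ \oo --> l' ->
  (fun n => u n + v n) @ \oo --> l + l'.
Proof.
move=> /cvg_vabsP ul /cvg_vabsP vl; apply/cvg_vabsP => e e0.
apply: filterS2 (ul e e0) (vl e e0) => n un vn.
by rewrite opprD addrACA vabsD_lt.
Qed.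

Lemma cvg_vabsM u v l l' : u @ \oo --> l -> v @ \oo --> l' ->
  (fun n => u n * v n) @ \oo --> l * l'.
Proof.
move=> /cvg_vabsP ul /cvg_vabsP vl; apply/cvg_vabsP => e e0.
(* The [+ 1] keeps the divisors of [e] positive when a limit is 0. *)
have pos x : 0 < vabs x + 1 by rewrite ltr_wpDl ?vabs_ge0.
have small e1 x y : 0 < e1 -> vabs x < e1 / (vabs y + 1) -> vabs (x * y) < e1.
  move=> e10 xe; apply: le_lt_trans (_ : vabs x * (vabs y + 1) < _).
    by rewrite vabsM ler_wpM2l ?vabs_ge0 // lerDl.
  by rewrite -ltr_pdivlMr.
have el := divr_gt0 e0 (pos l); have el' := divr_gt0 e0 (pos l').
apply: filterS2 (filterI (ul e e0) (ul _ el')) (filterI (vl 1 ltr01) (vl _ el)).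
move=> n [un un'] [vn vn'].
have -> : u n * v n - l * l' =
    (u n - l) * (v n - l') + (v n - l') * l + (u n - l) * l' by ring.
apply: vabsD_lt; first apply: vabsD_lt; try exact: small.
rewrite vabsM (le_lt_trans _ un) // ler_piMr ?vabs_ge0 //.
exact: ltW.
Qed.

Lemma cvg_vabsZ x u l : u @ \oo --> l -> (fun n => x * u n) @ \oo --> x * l.
Proof. exact: cvg_vabsM (cvg_vabs_cst (x := x)). Qed.

Lemma cvg_vabsV u l : l != 0 -> u @ \oo --> l -> (fun n => (u n)^-1) @ \oo --> l^-1.
Proof.
move=> l0 /cvg_vabsP ul; apply/cvg_vabsP => e e0.
have vl0 : 0 < vabs l by rewrite vabs_gt0.
have e1 : 0 < e * vabs l ^+ 2 by rewrite mulr_gt0 ?exprn_gt0.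
apply: filterS2 (ul _ vl0) (ul _ e1) => n un1 un2.
(* By dominance the absolute value is eventually constant, so the denominators below need no further
   lower bound. *)
have un : vabs (u n) = vabs l by rewrite -(subrK l (u n)) addrC vabs_dominant.
have un0 : u n != 0 by rewrite -vabs_gt0 un.
have -> : (u n)^-1 - l^-1 = (l - u n) * (u n * l)^-1 by field; rewrite l0 un0.
by rewrite vabsM vabsV vabsM un vabs_subC -expr2 ltr_pdivrMr ?exprn_gt0.
Qed.

Lemma cvg_vabs_sum m (F : nat -> nat -> K) (l : nat -> K) :
  (forall i, (i < m)%N -> F i @ \oo --> l i) ->
  (fun n => \sum_(0 <= i < m) F i n) @ \oo --> \sum_(0 <= i < m) l i.
Proof.
elim: m => [_|m IH Fl].
  rewrite big_nil; under eq_fun => n do rewrite big_nil.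
  exact: cvg_vabs_cst.
rewrite big_nat_recr //=; under eq_fun => n do rewrite big_nat_recr //=.
apply: cvg_vabsD; last exact: Fl.
by apply: IH => i im; apply: Fl; rewrite ltnW.
Qed.

Hypothesis complete : forall F : set_system K, ProperFilter F -> cauchy F -> cvg F.

(** A difference of distant terms telescopes, and its absolute value is at most that of the largest
    step; so small consecutive steps already make the sequence Cauchy. *)
Lemma ultrametric_cvg u :
  (fun n => u n.+1 - u n) @ \oo --> (0 : K) -> cvg (u @ \oo).
Proof.
move=> /cvg_vabsP u0; apply: complete; apply/cauchy_exP => e e0.
have [N _ uN] := u0 e e0; exists (u N); exists N => // n /= /subnKC <-.
rewrite /= ballEmdist /=; change (vabs (u N - u (N + (n - N))%N) < e).
elim: (n - N)%N => [|m IH]; first by rewrite addn0 subrr vabs0.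
rewrite addnS vabs_subC -(subrKA (u (N + m)%N)) vabsD_lt //.
  by have := uN (N + m)%N (leq_addr _ _); rewrite subr0.
by rewrite vabs_subC.
Qed.

Lemma near_expr_lt (rho : R) e : 0 <= rho < 1 -> 0 < e ->
  \forall n \near \oo, rho ^+ n < e.
Proof.
move=> /andP[r0 r1] e0.
have : (fun n => rho ^+ n) @ \oo --> (0 : R) by apply: cvg_expr; rewrite ger0_norm.
move=> /cvgrPdist_lt/(_ e e0); apply: filterS => n.
by rewrite sub0r normrN ger0_norm ?exprn_ge0.
Qed.

Lemma cvg_geometric_bound u (rho : R) : 0 <= rho < 1 ->
  (forall n, vabs (u n) <= rho ^+ n) -> u @ \oo --> (0 : K).
Proof.
move=> r01 ur; apply/cvg_vabsP => e e0.
apply: filterS (near_expr_lt r01 e0) => n; rewrite subr0; exact: le_lt_trans.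
Qed.

Lemma geometric_series_cvg u (rho : R) : 0 <= rho < 1 ->
  (forall n, vabs (u n) <= rho ^+ n) -> cvg (series u @ \oo).
Proof.
move=> r01 ur; apply: ultrametric_cvg.
under eq_fun => n do rewrite seriesSr addrC addKr.
exact: cvg_geometric_bound ur.
Qed.

Lemma geometric_series_tail u (rho : R) l M : 0 <= rho < 1 ->
  (forall n, vabs (u n) <= rho ^+ n) -> series u @ \oo --> l ->
  vabs (l - series u M) <= rho ^+ M.
Proof.
move=> /andP[r0 r1] ur ul; apply: (cvg_vabs_le ul).
exists M => // n /= Mn; rewrite /series /= (big_cat_nat (leq0n _) Mn) /= addrAC subrr add0r.
apply: vabs_sum_le => [|i]; rewrite ?exprn_ge0 // mem_index_iota => /andP[Mi _] _.
by rewrite (le_trans (ur i)) // ler_wiXn2l // ltW.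
Qed.

End Ultrametric.

(** Legendre's formula: with m = n + 1, the bound [partial] follows by induction from p floor(m /
    p^(L+1)) <= floor(m / p^L). For p^L the largest power of p below or equal to m, the leftover
    quotient is at least 1, which improves m to n. *)
Lemma logn_fact_leq (p n : nat) : prime p -> (p.-1 * logn p n.+1`! <= n)%N.
Proof.
move=> p_prime; have p_gt1 := prime_gt1 p_prime; set m := n.+1.
have partial L :
    (p.-1 * (\sum_(1 <= k < L.+1) m %/ p ^ k) + m %/ p ^ L <= m)%N.
  elim: L => [|L]; first by rewrite big_geq // muln0 expn0 divn1.
  apply: leq_trans; rewrite big_nat_recr //= mulnDr -addnA leq_add2l.
  rewrite -mulSnr prednK ?prime_gt0 // expnS mulnC [(p * _)%N]mulnC divnMA.
  exact: leq_divM.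
have /andP[m1 m2] := trunc_log_bounds p_gt1 (ltn0Sn n : 0 < m)%N.
have Lm : (trunc_log p m <= m)%N.
  by rewrite ltnW // (leq_trans _ m1) // ltn_expl.
rewrite logn_fact // (@big_cat_nat _ _ _ (trunc_log p m).+1) //=.
rewrite [X in (_ + X)%N]big_nat_cond [X in (_ + X)%N]big1; last first.
  move=> k /andP[/andP[Lk _] _]; rewrite divn_small //.
  by rewrite (leq_trans m2) // leq_exp2l.
rewrite addn0 -ltnS; apply: leq_trans (partial (trunc_log p m)).
by rewrite -addn1 leq_add2l divn_gt0 ?expn_gt0 ?prime_gt0.
Qed.

(** * The p-adic absolute value of integers, factorials and binomial coefficients *)

Section PadicAbs.
Context {R : realType} (p : nat) (p_prime : prime p) {K : valuedClosedField R}.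
Hypothesis vabs_p : vabs (p%:R : K) = p%:R^-1.
Notation r := (exp_radius R p).

Lemma vabs_p_lt1 : vabs (p%:R : K) < 1.
Proof. by rewrite vabs_p invf_lt1 ?ltr1n ?ltr0n ?prime_gt1 ?prime_gt0. Qed.

Lemma vabs_p_gt0 : 0 < vabs (p%:R : K).
Proof. by rewrite vabs_p invr_gt0 ltr0n prime_gt0. Qed.

Lemma vabs_natr_coprime n : coprime p n -> vabs (n%:R : K) = 1.
Proof.
case: n => [|n] pn; first by move: pn p_prime; rewrite /coprime gcdn0 => /eqP ->.
(* Bezout gives a n = b p + 1, of absolute value 1; as neither factor on the left exceeds 1, both
   equal 1. *)
have [a b ab _] := egcdnP p (ltn0Sn n).
have : vabs (a%:R * n.+1%:R : K) = 1.
  rewrite -natrM ab gcdnC (eqP pn) natrD natrM addrC vabs_dominant ?vabs1 //.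
  by rewrite vabsM (le_lt_trans _ vabs_p_lt1) // ler_piMl ?vabs_ge0 ?vabs_natr_le1.
rewrite vabsM => abE; apply/eqP; rewrite eq_le vabs_natr_le1 /= -abE.
by rewrite ler_piMl ?vabs_ge0 ?vabs_natr_le1.
Qed.

Lemma vabs_natr n : (0 < n)%N ->
  vabs (n%:R : K) = vabs (p%:R : K) ^+ logn p n.
Proof.
move=> n0; have [m pm {1}->] := pfactor_coprime p_prime n0.
by rewrite natrM natrX vabsM vabs_natr_coprime // mul1r vabsX.
Qed.

Lemma natr_neq0 n : (0 < n)%N -> (n%:R : K) != 0.
Proof.
by move=> n0; rewrite -vabs_gt0 vabs_natr // exprn_gt0 // vabs_p_gt0.
Qed.

Lemma exp_radius_gt0 : 0 < r.
Proof. by rewrite powR_gt0 // ltr0n prime_gt0. Qed.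

Lemma exp_radiusX : r ^+ p.-1 = vabs (p%:R : K).
Proof.
have p1 : (0 < p.-1)%N by rewrite -ltnS prednK ?prime_gt0 // prime_gt1.
rewrite -powR_mulrn ?ltW ?exp_radius_gt0 // -powRrM mulNr mulVf ?pnatr_eq0 -?lt0n //.
by rewrite powR_inv1 // vabs_p.
Qed.

Lemma exp_radius_lt1 : r < 1.
Proof.
have p1 : (0 < p.-1)%N by rewrite -ltnS prednK ?prime_gt0 // prime_gt1.
by rewrite -(@expr_lt1 _ p.-1) ?ltW ?exp_radius_gt0 // exp_radiusX vabs_p_lt1.
Qed.

(** Since r^(p-1) = |p|, the right side is r to the power (p-1) times the valuation of the
    factorial. The exponent n, one less than the argument, is what later leaves a spare factor |u -
    1|. *)
Lemma exp_radius_fact n : r ^+ n <= vabs (n.+1`!%:R : K).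
Proof.
rewrite vabs_natr ?fact_gt0 // -exp_radiusX -exprM.
by rewrite ler_wiXn2l ?ltW ?exp_radius_gt0 ?exp_radius_lt1 // logn_fact_leq.
Qed.

Lemma pbinom_le z n : vabs (z : K) <= 1 -> vabs (pbinom z n.+1) * r ^+ n <= 1.
Proof.
move=> z1; rewrite vabsM vabsV -mulrA mulr_ile1 ?vabs_ge0 //.
- by rewrite mulr_ge0 ?invr_ge0 ?vabs_ge0 // exprn_ge0 // ltW ?exp_radius_gt0.
- rewrite vabs_prod; apply: prodr_ile1 => i _.
  by rewrite vabs_ge0 vabsB_le // vabs_natr_le1.
- rewrite mulrC ler_pdivrMr ?mul1r ?exp_radius_fact //.
  by rewrite vabs_gt0 natr_neq0 // fact_gt0.
Qed.

End PadicAbs.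

(** * Powers with p-adic exponents as binomial series *)

Section BinomialSeries.
Context {R : realType} (p : nat) (p_prime : prime p) {K : valuedClosedField R}.
Hypothesis hK : is_padic_complex p K.
Notation r := (exp_radius R p).
Implicit Types u z : K.

Let vabs_p : vabs (p%:R : K) = p%:R^-1.
Proof. by case: hK. Qed.

Let complete : forall F : set_system K, ProperFilter F -> cauchy F -> cvg F.
Proof. by case: hK. Qed.

Let r_gt0 : 0 < r. Proof. exact: exp_radius_gt0. Qed.

Lemma pbinom0 z : pbinom z 0 = 1.
Proof. by rewrite /pbinom big_ord0 fact0 divr1. Qed.

Lemma pbinomS z n : pbinom (z + 1) n.+1 = pbinom z n.+1 + pbinom z n.
Proof.
have nat0 m : (m.+1%:R : K) != 0 by exact: (natr_neq0 p_prime vabs_p).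
have fact0 m : (m`!%:R : K) != 0 by rewrite (natr_neq0 p_prime vabs_p) // fact_gt0.
rewrite /pbinom big_ord_recl [in RHS]big_ord_recr /= subr0 factS natrM.
rewrite (eq_bigr (fun i : 'I_n => z - i%:R)) => [|i _]; last first.
  by rewrite /= /bump /= -natr1; ring.
rewrite -natr1; field; rewrite fact0 /=.
by rewrite natr1 nat0.
Qed.

(** Writing |u - 1| as (|u - 1| / r) r leaves the binomial coefficient times a power of r, which
    [pbinom_le] bounds by 1. The geometric ratio does not depend on [z], so convergence is uniform
    in the exponent. *)
Lemma ppow_term_le u z n : vabs (u - 1) < r -> vabs z <= 1 ->
  vabs (pbinom z n * (u - 1) ^+ n) <= (vabs (u - 1) / r) ^+ n.
Proof.
move=> ur z1; case: n => [|n]; first by rewrite pbinom0 !expr0 mulr1 vabs1.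
rewrite vabsM vabsX -[in X in _ * X](divfK (lt0r_neq0 r_gt0) (vabs (u - 1))).
rewrite exprMn mulrCA ler_piMr ?exprn_ge0 ?divr_ge0 ?vabs_ge0 ?(ltW r_gt0) //.
rewrite exprSr mulrA mulr_ile1 ?(pbinom_le p_prime vabs_p) ?(ltW r_gt0) //;
  last by rewrite ltW // (exp_radius_lt1 p_prime vabs_p).
by rewrite mulr_ge0 ?vabs_ge0 ?exprn_ge0 ?(ltW r_gt0).
Qed.

(** The coefficient absorbs only n of the n + 1 factors. The remaining |u - 1| survives division by
    q - 1 and keeps q-numbers in the unit ball. *)
Lemma ppow_termS_le u z n : vabs (u - 1) < r -> vabs z <= 1 ->
  vabs (pbinom z n.+1 * (u - 1) ^+ n.+1) <= vabs (u - 1).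
Proof.
move=> ur z1; rewrite exprSr mulrA vabsM ler_piMl ?vabs_ge0 //.
apply: le_trans (pbinom_le p_prime vabs_p n z1).
by rewrite vabsM vabsX ler_wpM2l ?vabs_ge0 // lerXn2r ?nnegrE ?vabs_ge0 ?ltW.
Qed.

Let ratio u : vabs (u - 1) < r -> 0 <= vabs (u - 1) / r < 1.
Proof.
by move=> ur; rewrite divr_ge0 ?vabs_ge0 ?ltW //= ltr_pdivrMr // mul1r.
Qed.

Lemma ppow_cvg u z : vabs (u - 1) < r -> vabs z <= 1 ->
  series (fun n => pbinom z n * (u - 1) ^+ n) @ \oo --> ppow u z.
Proof.
move=> ur z1; apply: (geometric_series_cvg complete (ratio ur)) => n.
exact: ppow_term_le.
Qed.

Lemma ppow_tail u z M : vabs (u - 1) < r -> vabs z <= 1 ->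
  vabs (ppow u z - \sum_(0 <= n < M) pbinom z n * (u - 1) ^+ n)
    <= (vabs (u - 1) / r) ^+ M.
Proof.
move=> ur z1; apply: (geometric_series_tail _ (ratio ur)); last exact: ppow_cvg.
by move=> n; exact: ppow_term_le.
Qed.

Lemma ppow_sub1_le u z : vabs (u - 1) < r -> vabs z <= 1 ->
  vabs (ppow u z - 1) <= vabs (u - 1).
Proof.
move=> ur z1; apply: (cvg_vabs_le (ppow_cvg ur z1)).
exists 1%N => // -[|n] //= _; rewrite /series /= big_nat_recl //=.
rewrite pbinom0 expr0 mulr1 addrAC subrr add0r.
by apply: vabs_sum_le => [|i _ _]; rewrite ?vabs_ge0 // ppow_termS_le.
Qed.

(** Pascal's rule gives a recursion between partial sums at z + 1 and at z, recorded as [SS]; the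
    identity is its limit. *)
Lemma ppowS u z : vabs (u - 1) < r -> vabs z <= 1 ->
  ppow u (z + 1) = ppow u z * u.
Proof.
move=> ur z1; have z11 : vabs (z + 1) <= 1 by rewrite vabsD_le ?vabs1.
rewrite -[X in _ * X](subrK 1) mulrDr mulr1 [RHS]addrC [_ * (u - 1)]mulrC.
have shift (v : nat -> K) (l : K) : v @ \oo --> l -> (fun n => v n.+1) @ \oo --> l.
  by move=> vl; rewrite (cvg_shiftS v).
pose S z n := series (fun k => pbinom z k * (u - 1) ^+ k) n.
have SS n : S (z + 1) n.+1 = S z n.+1 + (u - 1) * S z n.
  rewrite /S /series /= big_nat_recl // [in RHS]big_nat_recl //= !pbinom0 -addrA.
  congr (_ + _); rewrite mulr_sumr -big_split; apply: eq_bigr => i _ /=.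
  by rewrite pbinomS exprS; ring.
apply: cvg_vabs_unique (shift _ _ (ppow_cvg ur z11)) _.
under eq_fun => n do rewrite [series _ _]SS.
exact: cvg_vabsD (shift _ _ (ppow_cvg ur z1)) (cvg_vabsZ (x := u - 1) (ppow_cvg ur z1)).
Qed.

Lemma ppowDn u z n : vabs (u - 1) < r -> vabs z <= 1 ->
  ppow u (z + n%:R) = ppow u z * u ^+ n.
Proof.
move=> ur z1; elim: n => [|n IH]; first by rewrite addr0 expr0 mulr1.
rewrite -natr1 addrA ppowS // ?IH ?exprSr ?mulrA //.
by rewrite vabsD_le // vabs_natr_le1.
Qed.

End BinomialSeries.

(** * q-numbers and their absolute values *)

Section QNumbers.
Context {R : realType} (p : nat) (p_prime : prime p) {K : valuedClosedField R}.
Hypothesis hK : is_padic_complex p K.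
Notation r := (exp_radius R p).
Variable q : K.
Hypothesis q_near1 : vabs (q - 1) < r.
Implicit Types w z : K.

Let vabs_p : vabs (p%:R : K) = p%:R^-1.
Proof. by case: hK. Qed.

Let q1_lt1 : vabs (q - 1) < 1.
Proof. exact: lt_trans q_near1 (exp_radius_lt1 p_prime vabs_p). Qed.

(** This is the q-number of a natural number in division-free form, so that u = 1 is not an
    exception. *)
Definition geom_sum (u : K) n : K := \sum_(i < n) u ^+ i.

Lemma geom_sumD (u : K) m n :
  geom_sum u (m + n) = geom_sum u m + u ^+ m * geom_sum u n.
Proof.
rewrite /geom_sum big_split_ord /= mulr_sumr; congr (_ + _).
by apply: eq_bigr => i _; rewrite exprD.
Qed.

Lemma geom_sumM (u : K) m j :
  geom_sum u (j * m) = geom_sum u m * geom_sum (u ^+ m) j.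
Proof.
elim: j => [|j IH]; first by rewrite /geom_sum !big_ord0 mulr0.
rewrite mulSn addnC geom_sumD IH /geom_sum big_ord_recr /= -exprM mulnC.
by rewrite mulrDr [X in _ + X]mulrC.
Qed.

Lemma geom_sum_le1 (u : K) n : vabs u <= 1 -> vabs (geom_sum u n) <= 1.
Proof. by move=> u1; apply: vabs_sum_le => // i _ _; exact: vabsX_le1. Qed.

Lemma vabs_subX1_le (u : K) n : vabs u <= 1 -> vabs (u ^+ n - 1) <= vabs (u - 1).
Proof.
by move=> u1; rewrite subrX1 vabsM ler_piMr ?vabs_ge0 // geom_sum_le1.
Qed.

Lemma vabs_qX n : vabs (q ^+ n) = 1.
Proof. by rewrite vabsX (vabs_near1 q1_lt1) expr1n. Qed.

(** By [geom_sumM], each further factor p contributes [p]_u with u = q^(p^N), and [p]_u differs from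
    p by a sum of terms u^i - 1, each at most |q - 1|. *)
Lemma geom_sum_pX_le N :
  vabs (geom_sum q (p ^ N)) <= Num.max (vabs (p%:R : K)) (vabs (q - 1)) ^+ N.
Proof.
have q1 : vabs q <= 1 by rewrite (vabs_near1 q1_lt1).
elim: N => [|N IH]; first by rewrite expr0 geom_sum_le1.
rewrite expnS geom_sumM exprSr; apply: vabsM_le IH _.
set u := q ^+ _; have -> : geom_sum u p = p%:R + \sum_(i < p) (u ^+ i - 1).
  by rewrite /geom_sum sumrB sumr_const card_ord addrC subrK.
apply: vabsD_le; first by rewrite le_max lexx.
apply: vabs_sum_le => [|i _ _]; first by rewrite le_max vabs_ge0.
rewrite le_max; apply/orP; right; rewrite /u -exprM; exact: vabs_subX1_le.
Qed.

Lemma geom_sum_pX_cvg0 : (fun N => geom_sum q (p ^ N)) @ \oo --> (0 : K).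
Proof.
apply: (cvg_geometric_bound _ geom_sum_pX_le).
by rewrite le_max vabs_ge0 gt_max (vabs_p_lt1 p_prime).
Qed.

Lemma geom_sumE n :
  geom_sum q n = \sum_(i < n) 'C(n, i.+1)%:R * (q - 1) ^+ i.
Proof.
have [->|q1] := eqVneq q 1.
  rewrite /geom_sum; case: n => [|n]; first by rewrite !big_ord0.
  rewrite [RHS]big_ord_recl subrr expr0 mulr1 bin1 [X in _ + X]big1 => [|i _]; last first.
    by rewrite lift0 exprS mul0r mulr0.
  by rewrite addr0 (eq_bigr (fun=> 1)) ?sumr_const ?card_ord // => i _; rewrite expr1n.
apply: (mulfI (_ : q - 1 != 0)); first by rewrite subr_eq0.
have qE : q = 1 + (q - 1) by rewrite addrC subrK.
rewrite -subrX1 {1}qE exprDn big_ord_recl /= !expr1n expr0 mulr1 bin0 mulr1n.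
rewrite addrAC subrr add0r mulr_sumr.
by apply: eq_bigr => i _; rewrite /= expr1n mul1r -mulr_natl exprS mulrCA.
Qed.

(* In the binomial expansion of (q ^ n - 1) / (q - 1) the constant term n
   strictly dominates all others. *)
Lemma vabs_geom_sum n : vabs (geom_sum q n) = vabs (n%:R : K).
Proof.
rewrite geom_sumE; case: n => [|n]; first by rewrite big_ord0.
rewrite big_ord_recl expr0 mulr1 bin1 vabs_dominant //.
have n0 : 0 < vabs (n.+1%:R : K).
  by rewrite vabs_gt0 (natr_neq0 p_prime vabs_p).
apply: vabs_sum_lt => // i _ _; rewrite lift0; set m := nat_of_ord i.
have m0 : 0 < vabs (m.+2%:R : K) by rewrite vabs_gt0 (natr_neq0 p_prime vabs_p).
(* This trades the binomial coefficient for the factor n + 1 over m + 2, so it suffices that |q -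
   1|^(m+1) < |m + 2|; that follows from the lower bound on |(m+2)!|. *)
have binE : (n.+1%:R * 'C(n, m.+1)%:R : K) = m.+2%:R * 'C(n.+1, m.+2)%:R.
  by rewrite -!natrM -mul_bin_diag.
have lt_m : vabs (q - 1) ^+ m.+1 < vabs (m.+2%:R : K).
  have fact_le : vabs (m.+2`!%:R : K) <= vabs (m.+2%:R : K).
    by rewrite factS natrM vabsM ler_piMr ?vabs_ge0 ?vabs_natr_le1.
  apply: lt_le_trans (le_trans (exp_radius_fact p_prime vabs_p m.+1) fact_le).
  by rewrite ltrXn2r ?vabs_ge0.
rewrite -(ltr_pM2l m0) vabsM mulrA -vabsM -binE vabsM vabsX mulrAC mulrC.
apply: le_lt_trans (_ : vabs (n.+1%:R : K) * vabs (q - 1) ^+ m.+1 < _).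
  by rewrite ler_piMl ?vabs_natr_le1 // mulr_ge0 ?vabs_ge0 ?exprn_ge0 ?vabs_ge0.
by rewrite mulrC ltr_pM2r.
Qed.

(** Hence q^n = 1 only for q = 1, and the denominator q^d - 1 is legitimate otherwise. *)
Lemma geom_sum_neq0 n : (0 < n)%N -> geom_sum q n != 0.
Proof.
move=> n0; rewrite -vabs_gt0 vabs_geom_sum vabs_gt0.
exact: (natr_neq0 p_prime vabs_p).
Qed.

Lemma qnumE w : q != 1 -> qnum q w = (ppow q w - 1) / (q - 1).
Proof. by move=> /negbTE q1; rewrite /qnum /qnum_frac q1 expr1. Qed.

Lemma qnum1E w : qnum 1 w = w.
Proof. by rewrite /qnum /qnum_frac eqxx divr1. Qed.

Lemma qnum_nat n : qnum q n%:R = geom_sum q n.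
Proof.
have [->|q1] := eqVneq q 1.
  rewrite qnum1E /geom_sum (eq_bigr (fun=> 1)) ?sumr_const ?card_ord //.
  by move=> i _; rewrite expr1n.
rewrite qnumE // (ppow_nat _ _ p_prime hK) subrX1 mulrAC mulfV ?mul1r //.
by rewrite subr_eq0.
Qed.

Lemma qnum_le1 w : vabs w <= 1 -> vabs (qnum q w) <= 1.
Proof.
move=> w1; have [->|q1] := eqVneq q 1; first by rewrite qnum1E.
rewrite qnumE // vabsM vabsV ler_pdivrMr ?mul1r ?vabs_gt0 ?subr_eq0 //.
exact: (ppow_sub1_le p_prime hK).
Qed.

Lemma qnumDn w n : vabs w <= 1 ->
  qnum q (w + n%:R) = qnum q w + ppow q w * geom_sum q n.
Proof.
move=> w1; have [q1|q1] := eqVneq q 1.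
  have -> : ppow q w = 1.
    apply/eqP; rewrite -subr_eq0 -vabs_eq0 eq_le vabs_ge0 andbT.
    by rewrite (le_trans (ppow_sub1_le p_prime hK q_near1 w1)) // q1 subrr vabs0.
  by rewrite mul1r -qnum_nat q1 !qnum1E.
rewrite !qnumE // (ppowDn p_prime hK) //; apply: (mulIf (_ : q - 1 != 0)).
  by rewrite subr_eq0.
rewrite [RHS]mulrDl !divfK ?subr_eq0 // -mulrA [_ * (q - 1)]mulrC -subrX1.
by ring.
Qed.

(** The identity [w]_q = [d]_q [w/d]_(q^d), where q^d - 1 cancels; at q = 1 it degenerates to w = d
    (w / d). *)
Lemma qnum_frac_scale d w : (0 < d)%N ->
  qnum q w = qnum q d%:R * qnum_frac q d w.
Proof.
move=> d0; rewrite qnum_nat; have [->|q1] := eqVneq q 1.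
  rewrite /qnum /qnum_frac eqxx divr1 /geom_sum (eq_bigr (fun=> 1)).
    by rewrite sumr_const card_ord mulrC divfK // (natr_neq0 p_prime vabs_p).
  by move=> i _; rewrite expr1n.
rewrite qnumE // /qnum_frac (negbTE q1) subrX1 -/(geom_sum q d).
by field; rewrite subr_eq0 q1 geom_sum_neq0.
Qed.

End QNumbers.

(** * Uniformly continuous integrands and the fermionic integral *)

Section FermionicIntegral.
Context {R : realType} (p : nat) (p_prime : prime p) (p_odd : odd p).
Context {K : valuedClosedField R}.
Hypothesis hK : is_padic_complex p K.
Notation r := (exp_radius R p).
Implicit Types (f : K -> K) (g h : nat -> K) (Q q z : K).

Let vabs_p : vabs (p%:R : K) = p%:R^-1.
Proof. by case: hK. Qed.

Let complete : forall F : set_system K, ProperFilter F -> cauchy F -> cvg F.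
Proof. by case: hK. Qed.

(* Uniform continuity for the p-adic topology; boundedness, which follows from
   it, is included so that products are immediate. *)
Definition padic_ucont g :=
  (exists B, forall y, vabs (g y) <= B) /\
  forall e : R, 0 < e -> \forall N \near \oo,
    forall y j, vabs (g (y + j * p ^ N)%N - g y) < e.

Lemma padic_ucont_cst c : padic_ucont (fun=> c).
Proof.
split=> [|e e0]; first by exists (vabs c).
by apply: nearW => N y j; rewrite subrr vabs0.
Qed.

Lemma padic_ucontD g h :
  padic_ucont g -> padic_ucont h -> padic_ucont (fun y => g y + h y).
Proof.
move=> [[B gB] gu] [[C hC] hu]; split => [|e e0].
  exists (Num.max B C) => y.
  by rewrite vabsD_le // le_max ?gB ?hC ?orbT.
apply: filterS2 (gu e e0) (hu e e0) => N gN hN y j.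
by rewrite opprD addrACA vabsD_lt.
Qed.

Lemma padic_ucontM g h :
  padic_ucont g -> padic_ucont h -> padic_ucont (fun y => g y * h y).
Proof.
move=> [[B gB] gu] [[C hC] hu]; split => [|e e0].
  by exists (B * C) => y; exact: vabsM_le.
have B0 : 0 <= B := le_trans (vabs_ge0 _) (gB 0%N).
have C0 : 0 <= C := le_trans (vabs_ge0 _) (hC 0%N).
have eB : 0 < e / (B + 1) by rewrite divr_gt0 // ltr_wpDl.
have eC : 0 < e / (C + 1) by rewrite divr_gt0 // ltr_wpDl.
have small D (x y : K) : 0 <= D -> vabs y <= D -> vabs x < e / (D + 1) -> vabs (x * y) < e.
  move=> D0 yD xe; apply: le_lt_trans (_ : vabs x * (D + 1) < _).
    by rewrite vabsM ler_wpM2l ?vabs_ge0 // (le_trans yD) // lerDl.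
  by rewrite -ltr_pdivlMr // ltr_wpDl.
apply: filterS2 (gu _ eC) (hu _ eB) => N gN hN y j.
set y' := (y + _)%N.
have -> : g y' * h y' - g y * h y = (g y' - g y) * h y' + (h y' - h y) * g y by ring.
apply: vabsD_lt; first exact: (small _ _ _ C0 (hC _) (gN _ _)).
exact: (small _ _ _ B0 (gB _) (hN _ _)).
Qed.

Lemma padic_ucontZ c g : padic_ucont g -> padic_ucont (fun y => c * g y).
Proof. by move=> gu; apply: padic_ucontM; first exact: padic_ucont_cst. Qed.

Lemma padic_ucontX g k : padic_ucont g -> padic_ucont (fun y => g y ^+ k).
Proof.
move=> gu; elim: k => [|k IH].
  by under eq_fun => y do rewrite expr0; exact: padic_ucont_cst.
by under eq_fun => y do rewrite exprS; exact: padic_ucontM.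
Qed.

Lemma padic_ucont_sum (I : Type) (s : seq I) (F : I -> nat -> K) :
  (forall i, padic_ucont (F i)) -> padic_ucont (fun y => \sum_(i <- s) F i y).
Proof.
move=> Fu; elim: s => [|i s IH].
  by under eq_fun => y do rewrite big_nil; exact: padic_ucont_cst.
by under eq_fun => y do rewrite big_cons; exact: padic_ucontD.
Qed.

Lemma padic_ucont_affine g a d :
  padic_ucont g -> padic_ucont (fun y => g (a + d * y)%N).
Proof.
move=> [[B gB] gu]; split=> [|e e0]; first by exists B => y.
apply: filterS (gu e e0) => N gN y j.
by rewrite mulnDr addnA mulnA.
Qed.

(** Stability under uniform limits, needed for the generating function, which is a uniform limit of
    polynomials in a q-number. *)
Lemma padic_ucont_lim g :
  (forall e : R, 0 < e -> exists2 h, padic_ucont h & forall y, vabs (g y - h y) < e) ->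
  padic_ucont g.
Proof.
move=> gh; split => [|e e0].
  have [h [[B hB] _] ghe] := gh 1 ltr01; exists (Num.max 1 B) => y.
  rewrite -(subrK (h y) (g y)) vabsD_le // le_max ?hB ?orbT //.
  by rewrite ltW.
have [h [_ hu] ghe] := gh e e0; apply: filterS (hu e e0) => N hN y j.
set y' := (y + _)%N.
have -> : g y' - g y = (g y' - h y') + (h y' - h y) - (g y - h y) by ring.
exact: vabsB_lt (vabsD_lt (ghe y') (hN y j)) (ghe y).
Qed.

(** The increment from y to y + j p^N is q^y [p^N]_q times a q-number of absolute value at most 1,
    so it is at most |[p^N]_q| whatever y and j are. *)
Lemma padic_ucont_geom_sum q :
  vabs (q - 1) < r -> padic_ucont (fun y => geom_sum q y).
Proof.
move=> qr; have q1 : vabs q <= 1.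
  by rewrite -[q]expr1 (vabs_qX p_prime hK qr).
split => [|e e0]; first by exists 1 => y; exact: geom_sum_le1.
have /cvg_vabsP := geom_sum_pX_cvg0 p_prime hK qr.
move=> /(_ e e0); apply: filterS => N; rewrite subr0 => gN y j; apply: le_lt_trans gN.
rewrite geom_sumD addrAC subrr add0r vabsM (vabs_qX p_prime hK qr) mul1r.
by rewrite geom_sumM vabsM ler_piMr ?vabs_ge0 // geom_sum_le1 // vabsX_le1.
Qed.

Lemma padic_ucont_exp q : vabs (q - 1) < r -> padic_ucont (fun y => q ^+ y).
Proof.
move=> qr.
under eq_fun => y do rewrite -(subrK 1 (q ^+ y)) subrX1.
apply: padic_ucontD (padic_ucont_cst 1).
exact: padic_ucontZ (padic_ucont_geom_sum qr).
Qed.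

Lemma padic_ucont_qnum q x : vabs (q - 1) < r -> vabs x <= 1 ->
  padic_ucont (fun y => qnum q (x + y%:R)).
Proof.
move=> qr x1; under eq_fun => y do rewrite (qnumDn p_prime hK) //.
apply: padic_ucontD (padic_ucont_cst _) _.
exact: padic_ucontZ (padic_ucont_geom_sum qr).
Qed.

Definition alt_sum g n : K := \sum_(0 <= y < n) (-1) ^+ y * g y.

Lemma alt_sum_block g m N (e : R) : odd m -> 0 < e ->
  (forall y j, vabs (g (y + j * p ^ N)%N - g y) < e) ->
  vabs (alt_sum g (m * p ^ N) - alt_sum g (p ^ N)) < e.
Proof.
move=> m_odd e0 ge.
have sgn j : \sum_(i < j) (-1) ^+ i = (odd j)%:R :> K.
  elim: j => [|j IH]; first by rewrite big_ord0.
  by rewrite big_ord_recr /= IH -signr_odd; case: (odd j); rewrite ?expr0 ?add0r // expr1 subrr.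
(* As p^N is odd, a shift by j p^N changes the signs by (-1)^j. Keeping the sum of signs as a factor
   lets the induction run over all j; it equals 1 for odd m. *)
have block j :
    vabs (alt_sum g (j * p ^ N) - (\sum_(i < j) (-1) ^+ i) * alt_sum g (p ^ N)) < e.
  elim: j => [|j IH].
    by rewrite /alt_sum mul0n big_geq // big_ord0 mul0r subrr vabs0.
  rewrite big_ord_recr /= mulrDl opprD.
  rewrite /alt_sum (@big_cat_nat _ _ _ (j * p ^ N)) ?leq_mul //=.
  rewrite addrACA vabsD_lt //.
  rewrite -{1}[(j * p ^ N)%N]add0n big_addn mulSn addnK mulr_sumr -sumrB.
  apply: vabs_sum_lt => // y _ _.
  rewrite exprD -[(-1) ^+ (j * _)]signr_odd oddM oddX p_odd orbT andbT signr_odd.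
  have -> : (-1) ^+ y * (-1) ^+ j * g (y + j * p ^ N)%N - (-1) ^+ j * ((-1) ^+ y * g y)
     = (-1) ^+ (y + j) * (g (y + j * p ^ N)%N - g y) by rewrite exprD; ring.
  by rewrite vabsM vabsX vabsN vabs1 expr1n mul1r.
by have := block m; rewrite sgn m_odd mul1r.
Qed.

Lemma alt_sum_block_cvg0 g m : odd m -> padic_ucont g ->
  (fun N => alt_sum g (m * p ^ N) - alt_sum g (p ^ N)) @ \oo --> (0 : K).
Proof.
move=> m_odd [_ gu]; apply/cvg_vabsP => e e0.
apply: filterS (gu e e0) => N gN; rewrite subr0; exact: alt_sum_block.
Qed.

Lemma alt_sum_cvg g : padic_ucont g -> cvg ((fun N => alt_sum g (p ^ N)) @ \oo).
Proof.
move=> gu; apply: (ultrametric_cvg complete).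
under eq_fun => N do rewrite expnS.
exact: alt_sum_block_cvg0.
Qed.

Definition alt_lim g : K := lim ((fun N => alt_sum g (p ^ N)) @ \oo).

Lemma alt_sum_mul_cvg g m : odd m -> padic_ucont g ->
  (fun N => alt_sum g (m * p ^ N)) @ \oo --> alt_lim g.
Proof.
move=> m_odd gu; have := cvg_vabsD (alt_sum_block_cvg0 m_odd gu) (alt_sum_cvg gu).
by rewrite add0r; under eq_fun => N do rewrite subrK.
Qed.

Lemma fermionic_sumE Q f N : fermionic_sum p Q f N =
  (1 + Q) * (1 + Q ^+ (p ^ N))^-1 * alt_sum (fun y => f y%:R * Q ^+ y) (p ^ N).
Proof.
rewrite /fermionic_sum /alt_sum; congr (_ * _).
  rewrite invf_div exprNn -signr_odd oddX p_odd orbT expr1 mulN1r opprK.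
  by [].
by apply: eq_bigr => y _; rewrite [in LHS]exprNn mulrCA.
Qed.

Let vabs2 : vabs (2 : K) = 1.
Proof. by rewrite (vabs_natr_coprime p_prime vabs_p) // coprimen2. Qed.

(** Here 2 dominates Q - 1, since |2| = 1 for odd p. *)
Lemma vabs_add1 Q : vabs (Q - 1) < 1 -> vabs (1 + Q) = 1.
Proof.
move=> Q1; have -> : 1 + Q = 2 + (Q - 1) by ring.
by rewrite vabs_dominant ?vabs2.
Qed.

Lemma add1_neq0 Q : vabs (Q - 1) < 1 -> 1 + Q != 0.
Proof. by move=> Q1; rewrite -vabs_gt0 vabs_add1. Qed.

Lemma fermionic_sum_cvg Q f : vabs (Q - 1) < r ->
  padic_ucont (fun y => f y%:R) ->
  fermionic_sum p Q f @ \oo --> (1 + Q) / 2 * alt_lim (fun y => f y%:R * Q ^+ y).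
Proof.
move=> Qr fu; rewrite (funext (fermionic_sumE Q f)).
(* This turns the normalising factor (1 + Q) / (1 + Q^(p^N)) into (1 + Q) / 2 in the limit. *)
have QX : (fun N => Q ^+ (p ^ N)) @ \oo --> (1 : K).
  under eq_fun => N do rewrite -(subrK 1 (Q ^+ _)) subrX1.
  have geom0 := cvg_vabsZ (x := Q - 1) (geom_sum_pX_cvg0 p_prime hK Qr).
  by have := cvg_vabsD geom0 (cvg_vabs_cst (x := 1 : K)); rewrite mulr0 add0r.
apply: cvg_vabsM; last first.
  exact: alt_sum_cvg (padic_ucontM fu (padic_ucont_exp Qr)).
apply: cvg_vabsZ; apply: cvg_vabsV; first by rewrite -vabs_gt0 vabs2.
exact: cvg_vabsD (cvg_vabs_cst (x := 1 : K)) QX.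
Qed.

Lemma fermionic_intE Q f : vabs (Q - 1) < r -> padic_ucont (fun y => f y%:R) ->
  fermionic_int p Q f = (1 + Q) / 2 * alt_lim (fun y => f y%:R * Q ^+ y).
Proof. by move=> Qr fu; apply: cvg_vabs_lim; exact: fermionic_sum_cvg. Qed.

Lemma cvg_fermionic_int Q f : vabs (Q - 1) < r -> padic_ucont (fun y => f y%:R) ->
  fermionic_sum p Q f @ \oo --> fermionic_int p Q f.
Proof. by move=> Qr fu; rewrite fermionic_intE //; exact: fermionic_sum_cvg. Qed.

Lemma fermionic_sumZ Q c f N :
  fermionic_sum p Q (fun y => c * f y) N = c * fermionic_sum p Q f N.
Proof.
rewrite /fermionic_sum mulrCA; congr (_ * _); rewrite mulr_sumr.
by apply: eq_bigr => y _; rewrite mulrA.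
Qed.

Lemma fermionic_sumB Q f1 f2 N :
  fermionic_sum p Q (fun y => f1 y - f2 y) N =
  fermionic_sum p Q f1 N - fermionic_sum p Q f2 N.
Proof.
rewrite /fermionic_sum -mulrBr -sumrB; congr (_ * _).
by apply: eq_bigr => y _; rewrite mulrBl.
Qed.

Lemma fermionic_sum_sum Q (I : Type) (s : seq I) (F : I -> K -> K) N :
  fermionic_sum p Q (fun y => \sum_(i <- s) F i y) N =
  \sum_(i <- s) fermionic_sum p Q (F i) N.
Proof.
rewrite /fermionic_sum -mulr_sumr; congr (_ * _); rewrite exchange_big /=.
by apply: eq_bigr => y _; rewrite mulr_suml.
Qed.

(** The normalising factor and all weights have absolute value 1. As the bound is uniform in N, it
    passes to integrals and justifies integrating term by term. *)
Lemma fermionic_sum_le Q f N (B : R) : vabs (Q - 1) < r ->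
  (forall y, vabs (f y%:R) <= B) -> vabs (fermionic_sum p Q f N) <= B.
Proof.
move=> Qr fB; have B0 := le_trans (vabs_ge0 _) (fB 0%N).
have r1 := exp_radius_lt1 p_prime vabs_p.
have Q1 := lt_trans Qr r1.
have vQ n : vabs (Q ^+ n) = 1 by exact: (vabs_qX p_prime hK).
rewrite fermionic_sumE !vabsM vabsV !vabs_add1 //; last first.
  by rewrite (le_lt_trans _ Q1) // vabs_subX1_le // -[Q]expr1 vQ.
rewrite invr1 !mul1r; apply: vabs_sum_le => // y _ _.
by rewrite !vabsM vQ vabsX vabsN vabs1 expr1n mul1r mulr1.
Qed.

Lemma sum_residues (F : nat -> K) d n : \sum_(0 <= y < d * n) F y =
  \sum_(0 <= a < d) \sum_(0 <= y < n) F (a + d * y)%N.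
Proof.
rewrite exchange_big /=; elim: n => [|n IH]; first by rewrite muln0 !big_geq.
rewrite big_nat_recr //= -IH (@big_cat_nat _ _ _ (d * n)) ?leq_mul //=; congr (_ + _).
by rewrite -{1}[(d * n)%N]add0n big_addn mulnS addnK.
Qed.

(** The left limit may be taken along d p^N. Writing the index as a + d y, the sign factors as
    (-1)^a (-1)^y because d is odd, which leaves one alternating sum in base q^d per residue a. *)
Lemma fermionic_int_distribution q d f : vabs (q - 1) < r -> (0 < d)%N -> odd d ->
  padic_ucont (fun y => f y%:R) ->
  fermionic_int p q f = (1 + q) / (1 + q ^+ d) *
    \sum_(0 <= a < d)
      (- q) ^+ a * fermionic_int p (q ^+ d) (fun y => f (a%:R + d%:R * y)).
Proof.
move=> qr d_gt0 d_odd fu.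
have vq n : vabs (q ^+ n) = 1 by exact: (vabs_qX p_prime hK).
have q1 : vabs (q ^+ d - 1) < 1.
  apply: le_lt_trans (lt_trans qr (exp_radius_lt1 p_prime vabs_p)).
  by rewrite vabs_subX1_le // -[q]expr1 vq.
have qdr : vabs (q ^+ d - 1) < r.
  by apply: le_lt_trans qr; rewrite vabs_subX1_le // -[q]expr1 vq.
have fau a : padic_ucont (fun y => f (a%:R + d%:R * y%:R)).
  have := padic_ucont_affine a d fu.
  by under eq_fun => y do rewrite natrD natrM.
pose g a (y : nat) := f (a%:R + d%:R * y%:R) * (q ^+ d) ^+ y.
have gu a : padic_ucont (g a) by exact: padic_ucontM (fau a) (padic_ucont_exp qdr).
have gE : alt_lim (fun y => f y%:R * q ^+ y) =
    \sum_(0 <= a < d) (- q) ^+ a * alt_lim (g a).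
  have fqu := padic_ucontM fu (padic_ucont_exp qr).
  apply: cvg_vabs_unique (alt_sum_mul_cvg d_odd fqu) _.
  have -> : (fun N => alt_sum (fun y => f y%:R * q ^+ y) (d * p ^ N)) =
      (fun N => \sum_(0 <= a < d) (- q) ^+ a * alt_sum (g a) (p ^ N)).
    apply/funext => N; rewrite /alt_sum sum_residues; apply: eq_bigr => a _.
    rewrite mulr_sumr; apply: eq_bigr => y _; rewrite /g natrD natrM.
    rewrite [(-1) ^+ _]exprD -[(-1) ^+ (d * _)]signr_odd oddM d_odd signr_odd.
    by rewrite [(- q) ^+ a]exprNn exprD exprM; ring.
  by apply: cvg_vabs_sum => a _; apply: cvg_vabsZ; exact: alt_sum_cvg.
rewrite fermionic_intE // gE.
under [in RHS]eq_bigr => a _ do rewrite fermionic_intE //.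
rewrite !mulr_sumr; apply: eq_bigr => a _; rewrite -/(g a).
have two0 : (2 : K) != 0 by rewrite -vabs_gt0 vabs2.
by field; rewrite two0 add1_neq0.
Qed.

End FermionicIntegral.

(** * Coefficients of the generating function and the q-Changhee polynomials *)

Section Changhee.
Context {R : realType} (p : nat) (p_prime : prime p) (p_odd : odd p).
Context {K : valuedClosedField R}.
Hypothesis hK : is_padic_complex p K.
Notation r := (exp_radius R p).

Let vabs_p : vabs (p%:R : K) = p%:R^-1.
Proof. by case: hK. Qed.

Lemma prod_stirling1 (z : K) n : \prod_(i < n) (z - i%:R) =
  \sum_(0 <= k < n.+1) (stirling1 n k)%:~R * z ^+ k.
Proof.
pose P : {poly int} := \prod_(i < n) ('X - (i%:R)%:P).
have szP : size P = n.+1.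
  by rewrite /P size_prod_XsubC /index_enum -enumT size_enum_ord.
have -> : \prod_(i < n) (z - i%:R) = (map_poly intr P).[z].
  rewrite /P rmorph_prod horner_prod; apply: eq_bigr => i _.
  by rewrite rmorphB /= map_polyX map_polyC /= hornerXsubC rmorph_nat.
rewrite (@horner_coef_wide _ n.+1) -?szP ?size_poly // szP big_mkord.
by apply: eq_bigr => k _; rewrite coef_map.
Qed.

Lemma pbinomE (z : K) n : pbinom z n =
  \sum_(0 <= k < n.+1) (n`!%:R^-1 * (stirling1 n k)%:~R) * z ^+ k.
Proof.
rewrite /pbinom prod_stirling1 mulrC mulr_sumr.
by apply: eq_bigr => k _; rewrite mulrA.
Qed.

Lemma fermionic_intZ (Q c : K) f : vabs (Q - 1) < r ->
  padic_ucont p (fun y => f y%:R) ->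
  fermionic_int p Q (fun y => c * f y) = c * fermionic_int p Q f.
Proof.
move=> Qr fu; apply: cvg_vabs_lim.
rewrite (funext (fermionic_sumZ p Q c f)); apply: cvg_vabsZ.
exact: cvg_fermionic_int.
Qed.

(** Once the lower coefficients vanish, evaluation at t = p^(k+1) bounds the m-th term by the later
    ones; dividing by |p^k|^m gives |a_m p^m| <= B |p|^k for every k. *)
Lemma power_series_eq0 (a : nat -> K) :
  (forall t, vabs t < r -> series (fun n => a n * t ^+ n) @ \oo --> (0 : K)) ->
  forall n, a n = 0.
Proof.
move=> a0; pose P : K := p%:R.
have P1 : vabs P < 1 := vabs_p_lt1 p_prime vabs_p.
have P0 : 0 < vabs P := vabs_p_gt0 p_prime vabs_p.
(* Since |p| = r^(p-1), strictness needs p - 1 > 1, that is p different from 2. *)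
have Pr : vabs P < r.
  rewrite -(exp_radiusX p_prime vabs_p) -[X in _ < X]expr1.
  have r0 : 0 < r := exp_radius_gt0 p_prime.
  have r1 : r < 1 := exp_radius_lt1 p_prime vabs_p.
  rewrite ltr_iXn2l //.
  by case: p p_prime p_odd => [|[|[|]]].
(* Beyond N a term is a difference of two partial sums of size below 1; the finite sum in the
   witness covers the earlier terms. *)
have [B [B0 aB]] : exists B, 0 <= B /\ forall n, vabs (a n * P ^+ n) <= B.
  have /cvg_vabsP/(_ 1 ltr01)[N _ sN] := a0 P Pr.
  exists (1 + \sum_(i < N) vabs (a i * P ^+ i)); split => [|n].
    by rewrite addr_ge0 // sumr_ge0 // => i _; exact: vabs_ge0.
  have [nN|Nn] := ltnP n N.
    rewrite (bigD1 (Ordinal nN)) //= addrCA lerDl addr_ge0 // sumr_ge0 // => i _.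
    exact: vabs_ge0.
  apply: le_trans (_ : 1 <= _); last first.
    by rewrite lerDl sumr_ge0 // => i _; exact: vabs_ge0.
  have sn1 := sN n.+1 (leqW Nn); have sn := sN n Nn.
  by have := vabsB_lt sn1 sn; rewrite /= !subr0 seriesSr addrAC subrr add0r => /ltW.
move=> m; elim/ltn_ind: m => m IH.
have bound k : vabs (a m * P ^+ m) <= B * vabs (P ^+ k).
  have tr : vabs (P ^+ k.+1) < r.
    apply: le_lt_trans Pr; rewrite vabsX exprS ler_piMr ?vabs_ge0 //.
    by rewrite exprn_ile1 ?vabs_ge0 ?ltW.
  have tE n : a n * (P ^+ k.+1) ^+ n = a n * P ^+ n * (P ^+ k) ^+ n.
    by rewrite exprS exprMn mulrA.
  have Pk1 : vabs (P ^+ k) <= 1 by rewrite vabsX_le1 // ltW.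
  have Pk0 : 0 < vabs (P ^+ k) by rewrite vabsX exprn_gt0.
  have : vabs (0 - a m * (P ^+ k.+1) ^+ m) <= B * vabs (P ^+ k) ^+ m.+1.
    apply: (cvg_vabs_le (a0 _ tr)); exists m.+1 => // M /= mM.
    rewrite /series /= (big_cat_nat _ mM) //= big_nat_recr //= big_nat big1.
      rewrite add0r addrAC subrr add0r; apply: vabs_sum_le => [|n].
        by rewrite mulr_ge0 ?exprn_ge0 ?vabs_ge0.
      rewrite mem_index_iota => /andP[mn _] _; rewrite tE.
      apply: vabsM_le (aB n) _; rewrite vabsX.
      by rewrite ler_wiXn2l ?vabs_ge0.
    by move=> i im; rewrite IH ?mul0r.
  rewrite sub0r vabsN tE vabsM [vabs (_ ^+ m)]vabsX exprS mulrA.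
  by rewrite ler_pM2r // exprn_gt0.
have : a m * P ^+ m == 0.
  rewrite -vabs_eq0 eq_le vabs_ge0 andbT leNgt; apply/negP => am.
  have B1 : 0 < B + 1 by rewrite ltr_wpDl.
  have P01 : 0 <= vabs P < 1 by rewrite vabs_ge0.
  have [k Pk] := filter_ex (near_expr_lt P01 (divr_gt0 am B1)).
  have := bound k; rewrite vabsX leNgt; case/negP.
  apply: le_lt_trans (_ : (B + 1) * vabs P ^+ k < _).
    by rewrite ler_wpM2r ?exprn_ge0 ?vabs_ge0 // lerDl.
  by rewrite mulrC -ltr_pdivlMr.
by rewrite mulf_eq0 expf_eq0 -vabs_eq0 -[P == 0]vabs_eq0 (gt_eqF P0) andbF orbF
  vabs_eq0 => /eqP.
Qed.

Variables q x : K.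
Hypothesis q_near1 : vabs (q - 1) < r.
Hypothesis x_le1 : vabs x <= 1.

Let arg_le1 y : vabs (x + y%:R) <= 1.
Proof. by rewrite vabsD_le // vabs_natr_le1. Qed.

Let qnum_ucont k : padic_ucont p (fun y => qnum q (x + y%:R) ^+ k).
Proof. exact: padic_ucontX (padic_ucont_qnum p_prime hK q_near1 x_le1). Qed.

Lemma padic_ucont_pbinom n :
  padic_ucont p (fun y => pbinom (qnum q (x + y%:R)) n).
Proof.
under eq_fun => y do rewrite pbinomE.
by apply: padic_ucont_sum => k; exact: padic_ucontZ.
Qed.

(** The integral of the falling factorial of [x+y]_q of length n, expanded in powers: the candidate
    for the n-th coefficient. *)
Definition changhee_moment n : K := \sum_(0 <= k < n.+1)
  (stirling1 n k)%:~R * fermionic_int p q (fun y => qnum q (x + y) ^+ k).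

Lemma pbinom_fermionic_cvg n :
  fermionic_sum p q (fun y => pbinom (qnum q (x + y)) n) @ \oo -->
    changhee_moment n / n`!%:R.
Proof.
under [X in fermionic_sum _ _ X]eq_fun => y do rewrite pbinomE.
rewrite (funext (fermionic_sum_sum p q _ _)).
rewrite mulrC /changhee_moment mulr_sumr; apply: cvg_vabs_sum => k _.
rewrite (funext (fermionic_sumZ p q _ _)) mulrA; apply: cvg_vabsZ.
exact: cvg_fermionic_int.
Qed.

Lemma is_qChanghee_moment : is_qChanghee p q x changhee_moment.
Proof.
move=> t tr; set F := Changhee_gf q x t.
pose P M y := \sum_(0 <= n < M) t ^+ n * pbinom (qnum q (x + y)) n.
pose rho := vabs t / r.
have r0 : 0 < r := exp_radius_gt0 p_prime.
have rho01 : 0 <= rho < 1.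
  by rewrite divr_ge0 ?vabs_ge0 ?(ltW r0) //= ltr_pdivrMr // mul1r.
have rhoX0 M : 0 <= rho ^+ M by rewrite exprn_ge0 //; case/andP: rho01.
have u1 : 1 + t - 1 = t by rewrite addrAC subrr add0r.
(* The truncation error is uniform in y. It yields both the continuity of [F] and, after
   integration, the distance from the partial sum [S M] to the integral of [F]. *)
have tail M (y : nat) : vabs (F y%:R - P M y%:R) <= rho ^+ M.
  have := @ppow_tail _ _ p_prime _ hK (1 + t) (qnum q (x + y%:R)) M.
  rewrite u1 => /(_ tr (qnum_le1 p_prime hK q_near1 (arg_le1 y))).
  by rewrite /P (eq_bigr _ (fun n _ => mulrC _ _)).
have Pu M : padic_ucont p (fun y => P M y%:R).
  by apply: padic_ucont_sum => n; apply: padic_ucontZ; exact: padic_ucont_pbinom.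
have Fu : padic_ucont p (fun y => F y%:R).
  apply: padic_ucont_lim => e e0.
  have [M Me] := filter_ex (near_expr_lt rho01 e0).
  by exists (fun y => P M y%:R) => // y; exact: le_lt_trans (tail M y) Me.
have intF := cvg_fermionic_int p_prime p_odd hK q_near1 Fu.
split=> //.
pose S := series (fun n => changhee_moment n * (t ^+ n / n`!%:R)).
have PS M : fermionic_sum p q (P M) @ \oo --> S M.
  rewrite (funext (fermionic_sum_sum p q _ _)); apply: cvg_vabs_sum => n _.
  rewrite (funext (fermionic_sumZ p q _ _)) mulrCA; apply: cvg_vabsZ.
  exact: pbinom_fermionic_cvg.
have SF M : vabs (S M - fermionic_int p q F) <= rho ^+ M.
  have PF := cvg_vabsD (cvg_vabsZ (x := -1) (PS M)) intF.
  rewrite vabs_subC addrC -mulN1r -[X in vabs X]subr0; apply: (cvg_vabs_le PF).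
  apply: nearW => N; rewrite subr0 addrC mulN1r -fermionic_sumB.
  by apply: (fermionic_sum_le p_prime p_odd hK).
have S0 : (fun M => S M - fermionic_int p q F) @ \oo --> (0 : K).
  exact: cvg_geometric_bound SF.
have := cvg_vabsD S0 (cvg_vabs_cst (x := fermionic_int p q F)).
by rewrite add0r; under eq_fun => M do rewrite subrK.
Qed.

Lemma qChangheeE : qChanghee p q x = changhee_moment.
Proof.
(* Existence rules out the default value of [xget]; uniqueness compares two coefficient sequences
   through [power_series_eq0]. *)
apply: xget_unique => [|c hc]; first exact: is_qChanghee_moment.
apply/funext => n.
have fact0 : (n`!%:R : K) != 0 by rewrite (natr_neq0 p_prime vabs_p) // fact_gt0.
apply/eqP; rewrite -subr_eq0; apply/eqP/(mulIf (invr_neq0 fact0)).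
rewrite mul0r; apply: (power_series_eq0 (a := fun n => (c n - changhee_moment n) / n`!%:R)).
move=> t tr; have [_ h1] := hc t tr; have [_ h2] := is_qChanghee_moment tr.
have := cvg_vabsD h1 (cvg_vabsZ (x := -1) h2); rewrite mulN1r subrr.
set f := (X in X @ _ --> _); set g := (X in _ -> X @ _ --> _).
suff -> : f = g by [].
apply/funext => N; rewrite /f /g /series /= mulN1r -sumrB.
by apply: eq_bigr => i _; rewrite -mulrBl mulrA mulrAC.
Qed.

End Changhee.

Unset Implicit Arguments.
Set Strict Implicit.

Theorem theorem6 (R : realType) (p : nat) (p_prime : prime p) (p_odd : odd p)
    (Cp : valuedClosedField R) (hCp : is_padic_complex p Cp)
    (q : Cp) (hq : vabs (1 - q) < exp_radius R p) (x : Cp) (hx : padic_int x)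
    (d : nat) (d_gt0 : (0 < d)%N) (d_odd : odd d) (n : nat) :
  qChanghee p q x n =
    (1 + q) / (1 + q ^+ d) *
    \sum_(0 <= k < n.+1) qnum q d%:R ^+ k *
      (\sum_(0 <= a < d)
         (- q) ^+ a * qEuler p q d k (a%:R + x) * (stirling1 n k)%:~R).
Proof.
have qr : vabs (q - 1) < exp_radius R p by rewrite vabs_subC.
have x1 : vabs x <= 1 by case: hx.
have q1 : vabs q <= 1 by rewrite -[q]expr1 (vabs_qX p_prime hCp qr).
have qdr : vabs (q ^+ d - 1) < exp_radius R p.
  by rewrite (le_lt_trans _ qr) // vabs_subX1_le.
have d0 : qnum q d%:R != 0.
  by rewrite (qnum_nat p_prime hCp) (geom_sum_neq0 p_prime hCp).
rewrite (qChangheeE p_prime p_odd hCp qr x1) /changhee_moment mulr_sumr.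
apply: eq_bigr => k _.
have Fu := padic_ucontX k (padic_ucont_qnum p_prime hCp qr x1).
rewrite (fermionic_int_distribution p_prime p_odd hCp qr d_gt0 d_odd Fu).
rewrite mulrCA; congr (_ * _); rewrite !mulr_sumr; apply: eq_bigr => a _.
(* The integrand of [qEuler] is the shifted integrand of the moment divided by [d]_q^k; this
   constant leaves the integral and cancels the factor in the goal. *)
have scale y : qnum_frac q d (a%:R + x + d%:R * y) ^+ k =
    (qnum q d%:R ^+ k)^-1 * qnum q (x + (a%:R + d%:R * y)) ^+ k.
  have -> : x + (a%:R + d%:R * y) = a%:R + x + d%:R * y by ring.
  rewrite (qnum_frac_scale p_prime hCp qr (_ + _) d_gt0) exprMn.
  by rewrite mulKf // expf_neq0.
rewrite /qEuler (funext scale) (fermionic_intZ p_prime p_odd hCp) //.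
  by field; rewrite expf_neq0.
have := padic_ucont_affine a d Fu.
by under eq_fun => y do rewrite natrD natrM.
Qed.
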